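(* For every integer $d>3$, let $A_d$ be the $(d-2)\times d$ matrix whose $i$-th row ($1\le i\le d-2$) has entries $1$ in columns $i$ and $i+1$, entry $-1$ in column $i+2$, and $0$ elsewhere (so $A_dx=0$ means $x_{i+2}=x_i+x_{i+1}$ for all $i$). Then $$F_{d+1}\le r(A_d)\le (d^2-d+1)F_{d-1}F_{d-2},$$ where $F_i$ is the Fibonacci sequence with $F_0=0$, $F_1=1$, $F_{i+2}=F_i+F_{i+1}$.
   Context: For a positive integer $N$, $[N]=\{1,\dots,N\}$. A $k$-coloring of a set $X$ is a surjective map $c:X\to\{1,\dots,k\}$; its color classes are the preimages of single colors. A $k$-coloring of $[kn]$ is equinumerous if every color class has exactly $n$ elements. Given a coloring of a set $S$ of integers, a vector is rainbow if all its entries lie in $S$ and its entries receive pairwise distinct colors. A rational matrix $A$ is rainbow partition $k$-regular if for all positive integers $n$ and every equinumerous $k$-coloring of $[kn]$ there exists a rainbow vector in $\ker(A)$. The rainbow number $r(A)$ is the smallest $k$ such that $A$ is rainbow partition $k$-regular. *)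

(* Defs.v *)
From mathcomp Require Import all_boot all_order all_algebra.

Set Implicit Arguments.
Unset Strict Implicit.
Unset Printing Implicit Defensive.

Import GRing.Theory.
Local Open Scope ring_scope.

Fixpoint fib (n : nat) : nat :=
  match n with
  | 0 => 0
  | m.+1 => match m with 0 => 1 | p.+1 => fib p + fib m end
  end%N.

Definition interval (N : nat) : seq nat := iota 1 N.

(* A coloring of S is represented by a total function on nat of which only the
   values on S are ever used. *)
Definition coloring (k : nat) (S : seq nat) (c : nat -> nat) : Prop :=
  (forall x, x \in S -> 1 <= c x <= k)%N /\
  (forall j, (1 <= j <= k)%N -> exists2 x, x \in S & c x = j).

Definition color_class (S : seq nat) (c : nat -> nat) (j : nat) : seq nat :=
  [seq x <- S | c x == j].

Definition equinumerous_coloring (k n : nat) (c : nat -> nat) : Prop :=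
  coloring k (interval (k * n)) c /\
  (forall j, (1 <= j <= k)%N ->
     size (color_class (interval (k * n)) c j) = n).

Definition rainbow (S : seq nat) (c : nat -> nat) (d : nat)
    (x : 'cV[rat]_d) : Prop :=
  exists y : 'I_d -> nat,
    [/\ forall i, x i 0 = (y i)%:R,
        forall i, y i \in S
      & forall i j, i != j -> c (y i) <> c (y j)].

Definition rainbow_partition_regular (m d : nat) (A : 'M[rat]_(m, d))
    (k : nat) : Prop :=
  forall (n : nat) (c : nat -> nat),
    (0 < n)%N -> equinumerous_coloring k n c ->
    exists x : 'cV[rat]_d, rainbow (interval (k * n)) c x /\ A *m x = 0.

(* r(A) = r; in particular, some k for which A is regular exists. *)
Definition is_rainbow_number (m d : nat) (A : 'M[rat]_(m, d)) (r : nat) : Prop :=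
  [/\ (0 < r)%N, rainbow_partition_regular A r
    & forall k, (0 < k)%N -> rainbow_partition_regular A k -> (r <= k)%N].

Definition fib_matrix (d : nat) : 'M[rat]_(d - 2, d) :=
  \matrix_(i < d - 2, j < d)
    if ((j == i :> nat) || (j == i.+1 :> nat)) then 1
    else if (j == i.+2 :> nat) then -1
    else 0.

(* Main.v *)
Require Import Defs.
From mathcomp Require Import all_boot all_order all_algebra.
From mathcomp Require Import zify boolp.

Set Implicit Arguments.
Unset Strict Implicit.
Unset Printing Implicit Defensive.

(** Kernel vectors are the sequences [a, b, a + b, a + 2 b, ...].

    Lower bound.  Colouring [1 .. k] injectively shows [d <= k].  For
    [4 <= k < F_{d+1}] colour [1 .. 2k] by the pairs
    [{1,4}], [{2,3}], [{5,7}], [{6,8}], [{9,10}], [{11,12}], ...  The last entry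
    [F_{d-2} a + F_{d-1} b] is at most [2 F_{d+1} - 2], which leaves at most
    fifteen starting pairs [(a, b)], and each of them already repeats a colour
    among its first four entries.

    Upper bound.  Let [P = F_{d-1}], [Q = F_{d-2}], [D = d^2 - d + 1] and
    [k = D P Q].  There are at least [P Q binom(D n, 2)] positive kernel vectors
    in [1 .. k n].  One that is not rainbow either has [a = b] (at most [k n] of
    these) or has two distinct entries of the same colour; since two entries
    determine the vector, there are at most [binom(d, 2) k n (n - 1)] of the
    latter, and the two bounds together are too small. *)

Lemma fibSS n : fib n.+2 = fib n + fib n.+1.
Proof. by []. Qed.

Lemma fib_gt0 n : 0 < n -> 0 < fib n.
Proof.
case: n => // n _; elim: n => // n IHn.
by rewrite fibSS addn_gt0 IHn orbT.
Qed.

Lemma fib_ratio_bounds n :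
  [/\ fib n.+2 <= fib n.+3, fib n.+3 <= 2 * fib n.+2,
      3 * fib n.+3 <= 5 * fib n.+2 + 1 & 3 * fib n.+2 <= 2 * fib n.+3 + 1].
Proof. by elim: n => // n [? ? ? ?]; rewrite (fibSS n.+2); split; lia. Qed.

Definition gfib (a b i : nat) : nat :=
  if i is j.+1 then a * fib j + b * fib j.+1 else a.

Lemma gfibSS a b i : gfib a b i.+2 = gfib a b i + gfib a b i.+1.
Proof. by case: i => [|i]; rewrite /gfib ?fibSS /=; lia. Qed.

Lemma gfib_last a b d : 1 < d ->
  gfib a b d.-1 = a * fib (d - 2) + b * fib (d - 1).
Proof. by case: d => [|[|d]] //; rewrite subn1 subn2. Qed.

Lemma gfib_unique d (z : nat -> nat) :
    (forall i, i.+2 < d -> z i.+2 = z i + z i.+1) ->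
  forall i, i < d -> z i = gfib (z 0) (z 1) i.
Proof.
move=> z_rec; elim/ltn_ind => -[|[|i]] IHi lt_id //.
  by rewrite /gfib muln0 muln1.
have lt_iSd := ltnW lt_id.
by rewrite z_rec // gfibSS (IHi i) ?(ltnW lt_iSd) // (IHi i.+1).
Qed.

Lemma gfib_shift a b i j :
  gfib a b (i + j) = gfib (gfib a b i) (gfib a b i.+1) j.
Proof.
rewrite -{2}[i]addn0 -addn1.
apply: (@gfib_unique j.+1 (fun m => gfib a b (i + m))) => // m _.
by rewrite !addnS gfibSS.
Qed.

Lemma gfib_gt0 a b i : 0 < a -> 0 < b -> 0 < gfib a b i.
Proof.
move=> a_gt0 b_gt0; case: i => // i.
by rewrite addn_gt0 !muln_gt0 b_gt0 (fib_gt0 (ltn0Sn i)) orbT.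
Qed.

Lemma ltn_gfib a b i j :
  0 < a -> 0 < b -> 1 < j -> i < j -> gfib a b i < gfib a b j.
Proof.
move=> a_gt0 b_gt0; elim/ltn_ind: j => -[|[|j]] // IHj _ lt_ij.
have [x_gt0 y_gt0] := (gfib_gt0 j a_gt0 b_gt0, gfib_gt0 j.+1 a_gt0 b_gt0).
rewrite gfibSS; have [->|[->|lt_ij']] : i = j.+1 \/ i = j \/ i < j by lia.
- by rewrite -[X in X < _]add0n ltn_add2r.
- by rewrite -[X in X < _]addn0 ltn_add2l.
by rewrite ltn_addl // IHj //; lia.
Qed.

Lemma leq_gfib a b i j :
  0 < a -> 0 < b -> 1 < j -> i <= j -> gfib a b i <= gfib a b j.
Proof.
move=> a_gt0 b_gt0 j_gt1; rewrite leq_eqVlt => /predU1P[-> //|lt_ij].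
by rewrite ltnW // ltn_gfib.
Qed.

Lemma gfib_neq a b i j :
  0 < a -> 0 < b -> a != b -> i < j -> gfib a b i != gfib a b j.
Proof.
move=> a_gt0 b_gt0 neq_ab lt_ij.
have [j_gt1|j_le1] := ltnP 1 j; first by rewrite neq_ltn ltn_gfib.
have [-> ->] : i = 0 /\ j = 1 by lia.
by rewrite /gfib muln0 muln1.
Qed.

Lemma gfib_inj_consecutive a b a' b' i :
    gfib a b i = gfib a' b' i -> gfib a b i.+1 = gfib a' b' i.+1 ->
  a = a' /\ b = b'.
Proof.
elim: i => [|i IHi] eq_i eq_iS.
  by move: eq_i eq_iS; rewrite /gfib /=; lia.
by apply: IHi => //; move: eq_i eq_iS; rewrite !gfibSS; lia.
Qed.

Lemma gfib_inj a b a' b' i j : i < j ->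
    gfib a b i = gfib a' b' i -> gfib a b j = gfib a' b' j ->
  a = a' /\ b = b'.
Proof.
move=> lt_ij eq_i; have -> : j = i + (j - i.+1).+1 by lia.
rewrite !gfib_shift eq_i => /addnI/eqP.
rewrite eqn_pmul2r ?fib_gt0 // => /eqP.
exact: gfib_inj_consecutive.
Qed.

Section FibMatrixKernel.
Variables (d : nat) (z : nat -> nat) (x : 'cV[rat]_d).
Local Open Scope ring_scope.
Import GRing.Theory Num.Theory.
Hypothesis xE : forall j : 'I_d, x j 0 = (z j)%:R.

Lemma fib_matrix_mulE (i : 'I_(d - 2)) :
  (fib_matrix d *m x) i 0 = (z i)%:R + (z i.+1)%:R - (z i.+2)%:R.
Proof.
have lt_i2 : (i.+2 < d)%N by have := ltn_ord i; lia.
have lt_i1 : (i.+1 < d)%N by lia.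
have lt_i0 : (i < d)%N by lia.
rewrite mxE (bigD1 (Ordinal lt_i0)) //= (bigD1 (Ordinal lt_i1)) /=; last first.
  by rewrite -val_eqE /=; lia.
rewrite (bigD1 (Ordinal lt_i2)) /=; last by rewrite -!val_eqE /=; lia.
rewrite big1 => [|j]; last first.
  rewrite -!val_eqE /= => /andP[/andP[neq_i0 neq_i1] neq_i2].
  by rewrite mxE (negPf neq_i0) (negPf neq_i1) (negPf neq_i2) mul0r.
rewrite !mxE /= !xE /= !eqxx orbT.
have -> : ((i.+2 == i) || (i.+2 == i.+1))%N = false by lia.
by rewrite !mul1r addr0 mulN1r addrA.
Qed.

Lemma fib_matrix_kerP :
  fib_matrix d *m x = 0 <->
  (forall i, (i.+2 < d)%N -> z i.+2 = (z i + z i.+1)%N).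
Proof.
split=> [ker i lt_i2|z_rec].
  have lt_i : (i < d - 2)%N by lia.
  have := fib_matrix_mulE (Ordinal lt_i).
  by rewrite ker mxE /= => /esym/eqP; rewrite subr_eq0 -natrD eqr_nat => /eqP.
apply/colP => i; rewrite fib_matrix_mulE mxE; apply/eqP.
by rewrite subr_eq0 -natrD eqr_nat z_rec //; have := ltn_ord i; lia.
Qed.

End FibMatrixKernel.

Lemma count_inj_leq_size (T1 T2 : eqType) (f : T1 -> T2) s t :
  injective f -> uniq s -> count (fun x => f x \in t) s <= size t.
Proof.
move=> f_inj s_uniq; rewrite -size_filter -(size_map f).
apply: uniq_leq_size => [|_ /mapP[x + ->]].
  by rewrite map_inj_uniq ?filter_uniq.
by rewrite mem_filter => /andP[].
Qed.

Lemma intervalE N : Defs.interval N = index_iota 1 N.+1.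
Proof. by rewrite /index_iota subn1. Qed.

Lemma mem_interval N x : (x \in Defs.interval N) = (0 < x <= N).
Proof. by rewrite mem_iota add1n. Qed.

Definition interval_pairs (N : nat) : seq (nat * nat) :=
  [seq (a, b) | a <- Defs.interval N, b <- Defs.interval N].

Lemma mem_interval_pairs N p :
  (p \in interval_pairs N) = (0 < p.1 <= N) && (0 < p.2 <= N).
Proof.
case: p => a b; rewrite -!mem_interval.
apply/allpairsP/andP => [[[? ?] [? ? [-> ->]]] //|[aI bI]].
by exists (a, b).
Qed.

Lemma interval_pairs_uniq N : uniq (interval_pairs N).
Proof. by apply: allpairs_uniq; rewrite ?iota_uniq // => -[? ?] []. Qed.

Lemma count_interval_pairs N (R : pred (nat * nat)) :
  count R (interval_pairs N) =
  \sum_(a <- Defs.interval N) count (fun b => R (a, b)) (Defs.interval N).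
Proof.
rewrite -sum1_count big_mkcond big_allpairs.
by apply: eq_bigr => a _; rewrite -big_mkcond sum1_count.
Qed.

Lemma count_diagonal_leq s N : uniq s -> {subset s <= interval_pairs N} ->
  count (fun p => p.1 == p.2) s <= N.
Proof.
move=> s_uniq sI.
rewrite -size_filter -[N in _ <= N](size_iota 1) -(size_map fst).
apply: uniq_leq_size => [|_ /mapP[p p_diag ->]].
  rewrite map_inj_in_uniq ?filter_uniq // => -[a b] [a' b'].
  by rewrite !mem_filter /= => /andP[/eqP-> _] /andP[/eqP-> _] ->.
move: p_diag; rewrite mem_filter => /andP[_ /sI].
by rewrite mem_interval_pairs -mem_interval => /andP[].
Qed.

Lemma leq_count_interval c N :
  c <= N -> c <= count (fun b => b <= c) (Defs.interval N).
Proof.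
move=> le_cN; rewrite -{1}(size_iota 1 c) -size_filter.
apply: uniq_leq_size (iota_uniq _ _) _ => b.
by rewrite mem_filter !mem_iota; lia.
Qed.

(* For [t < m] and [P t < a <= P (t + 1)], every [b <= Q (m - t - 1)] works. *)
Lemma count_lattice_triangle P Q m : 0 < P -> 0 < Q ->
  P * Q * 'C(m, 2) <=
  count (fun p => p.1 * Q + p.2 * P <= P * Q * m) (interval_pairs (P * Q * m)).
Proof.
move=> P_gt0 Q_gt0; set N := P * Q * m; rewrite count_interval_pairs.
have le_N : m * P <= N by rewrite /N mulnAC mulnC leq_pmulr.
pose row a := count (fun b => a * Q + b * P <= N) (Defs.interval N).
have leq_row t a : t < m -> t * P <= a < t.+1 * P -> Q * (m - t.+1) <= row a.+1.
  move=> lt_tm /andP[_ lt_a]; set c := Q * _.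
  have N_split : N = t.+1 * P * Q + c * P.
    by rewrite /N /c -[in LHS](subnKC lt_tm); lia.
  have le_c : c <= N.
    by rewrite N_split; apply: leq_trans (leq_addl _ _); rewrite leq_pmulr.
  apply: leq_trans (leq_count_interval le_c) _; apply: sub_count => b /= le_bc.
  by rewrite N_split leq_add ?leq_mul2r ?lt_a ?le_bc ?orbT.
apply: (@leq_trans (\sum_(0 <= a < m * P) row a.+1)); last first.
  rewrite [X in _ <= \sum_(_ <- X) _]intervalE big_add1.
  rewrite [X in _ <= X](@big_cat_nat _ _ _ (m * P)) //=.
  exact: leq_addr.
rewrite big_nat_mul -bin2_sum big_distrr big_nat_rev /=.
rewrite big_nat [X in _ <= X]big_nat; apply: leq_sum => t /= lt_tm.
apply: (@leq_trans (\sum_(t * P <= a < t.+1 * P) Q * (m - t.+1))).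
  by rewrite sum_nat_const_nat -mulnBl subSnn mul1n add0n mulnA.
by rewrite big_nat [X in _ <= X]big_nat; apply: leq_sum => a; apply: leq_row.
Qed.

Definition kernel_starts (d N : nat) : seq (nat * nat) :=
  [seq p <- interval_pairs N | gfib p.1 p.2 d.-1 <= N].

Lemma mem_kernel_starts d N a b : 2 < d ->
  ((a, b) \in kernel_starts d N) = [&& 0 < a, 0 < b & gfib a b d.-1 <= N].
Proof.
move=> d_gt2; rewrite mem_filter mem_interval_pairs /=.
apply/idP/and3P => [/and3P[-> /andP[-> _] /andP[-> _]] //|].
case=> a_gt0 b_gt0 le_lastN; have le_N i : i < d -> gfib a b i <= N.
  by move=> lt_id; apply: leq_trans le_lastN; apply: leq_gfib => //; lia.
rewrite le_lastN a_gt0 b_gt0 /=; apply/andP; split.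
  by apply: (le_N 0); lia.
by have := le_N 1; rewrite /gfib muln0 muln1; apply; lia.
Qed.

Lemma gfib_mem_interval d N p i : 2 < d -> p \in kernel_starts d N -> i < d ->
  gfib p.1 p.2 i \in Defs.interval N.
Proof.
case: p => a b d_gt2; rewrite mem_kernel_starts //.
case/and3P=> a_gt0 b_gt0 le_lastN lt_id.
rewrite mem_interval gfib_gt0 //=; apply: leq_trans le_lastN.
by apply: leq_gfib => //; lia.
Qed.

Definition entry_colors (c : nat -> nat) (d : nat) (p : nat * nat) : seq nat :=
  mkseq (fun i => c (gfib p.1 p.2 i)) d.

Lemma rainbow_kernelP d N c : 2 < d ->
  (exists x : 'cV[rat]_d,
     rainbow (Defs.interval N) c x /\ (fib_matrix d *m x = 0)%R) <->
  (exists2 p, p \in kernel_starts d N & uniq (entry_colors c d p)).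
Proof.
move=> d_gt2; split=> [[x [[y [xE yI y_col]] ker]]|[[a b] start col_uniq]].
  have [z zE] : exists z : nat -> nat, forall j : 'I_d, z j = y j.
    by exists (fun i => oapp y 0 (insub i)) => j; rewrite valK.
  have xzE (j : 'I_d) : x j 0%R = ((z j)%:R)%R by rewrite xE zE.
  have gfibE := gfib_unique (proj1 (fib_matrix_kerP xzE) ker).
  have zI i : i < d -> 0 < z i <= N.
    by move=> lt_id; rewrite -mem_interval (zE (Ordinal lt_id)).
  exists (z 0, z 1).
    rewrite mem_kernel_starts // -gfibE; last by lia.
    by have := zI 0; have := zI 1; have := zI d.-1; lia.
  apply/mkseq_uniqP => i j /= lt_id lt_jd; rewrite -!gfibE //.
  rewrite (zE (Ordinal lt_id)) (zE (Ordinal lt_jd)) => eq_col.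
  have [[]//|neq_ij] := eqVneq (Ordinal lt_id) (Ordinal lt_jd).
  by case: (y_col _ _ neq_ij).
pose x : 'cV[rat]_d := (\col_i (gfib a b i)%:R)%R.
have xE (j : 'I_d) : x j 0%R = ((gfib a b j)%:R)%R by rewrite mxE.
exists x; split; last by apply/(fib_matrix_kerP xE) => i _; apply: gfibSS.
exists (fun i => gfib a b i); split=> // [i|i j /eqP neq_ij eq_col].
  exact: gfib_mem_interval start (ltn_ord i).
by apply/neq_ij/val_inj/(mkseq_uniqP _ _ col_uniq); rewrite ?inE /=.
Qed.

Lemma is_rainbow_number_exists m d (A : 'M[rat]_(m, d)) k :
    0 < k -> rainbow_partition_regular A k ->
  exists2 r, is_rainbow_number A r & r <= k.
Proof.
move=> k_gt0 regk.
pose positive_regular j := (0 < j) && `[< rainbow_partition_regular A j >].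
have regP j : 0 < j -> rainbow_partition_regular A j -> positive_regular j.
  by move=> j_gt0 regj; rewrite /positive_regular j_gt0; apply/asboolP.
have ex_reg : exists j, positive_regular j by exists k; apply: regP.
case: (ex_minnP ex_reg) => r /andP[r_gt0 /asboolP regr] min_r.
exists r; last exact/min_r/regP.
by split=> // j j_gt0 regj; apply/min_r/regP.
Qed.

Lemma equinumerous_coloring_count k n c : 0 < n ->
    (forall j, count (fun x => c x == j) (Defs.interval (k * n)) =
               (0 < j <= k) * n) ->
  equinumerous_coloring k n c.
Proof.
move=> n_gt0 countE; split=> [|j j_col]; last first.
  by rewrite size_filter countE j_col mul1n.
have used_color j :
    has (fun x => c x == j) (Defs.interval (k * n)) = (0 < j <= k).
  by rewrite has_count countE muln_gt0 n_gt0 andbT lt0b.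
split=> [x xI|j]; first by rewrite -used_color; apply/hasP; exists x.
by rewrite -used_color => /hasP[x xI /eqP]; exists x.
Qed.

Lemma rainbow_partition_regular_dim m d (A : 'M[rat]_(m, d)) k :
  rainbow_partition_regular A k -> d <= k.
Proof.
move=> regk; have eq_id : equinumerous_coloring k 1 id.
  apply: equinumerous_coloring_count => // j.
  by rewrite !muln1 count_uniq_mem ?iota_uniq // mem_interval.
have [_ [[y [_ yI y_inj]] _]] := regk 1 id isT eq_id.
have y_uniq : uniq [seq y i | i <- enum 'I_d].
  rewrite map_inj_uniq ?enum_uniq // => i j eq_y.
  by have [//|/y_inj] := eqVneq i j.
rewrite -[d]size_enum_ord -(size_map y) -[k]muln1 -(size_iota 1 (k * 1)).
by apply: uniq_leq_size => // _ /mapP[i _ ->].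
Qed.

(* The colour classes are [{1,4}], [{2,3}], [{5,7}], [{6,8}] and then
   [{2j-1, 2j}] for [j > 4]. *)
Definition pair_coloring (x : nat) : nat :=
  nth (uphalf x) [:: 0; 1; 2; 2; 1; 3; 4; 3; 4] x.

Lemma pair_coloring_equinumerous k : 3 < k ->
  equinumerous_coloring k 2 pair_coloring.
Proof.
move=> k_gt3; apply: equinumerous_coloring_count => // j.
have [m ->] : exists m, k = m + 4 by exists (k - 4); rewrite subnK.
have pair_coloring_gt8 x : 8 < x -> pair_coloring x = uphalf x.
  by move=> x_gt8; rewrite /pair_coloring nth_default.
elim: m => [|m IHm]; first by case: j => [|[|[|[|[|j]]]]].
have -> : (m.+1 + 4) * 2 = (m + 4) * 2 + 2 by lia.
by rewrite /Defs.interval iotaD count_cat IHm /= !pair_coloring_gt8; lia.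
Qed.

Lemma pair_coloring_repeats a b : 0 < a -> 0 < b -> gfib a b 6 < 2 * fib 8 ->
  ~~ uniq (entry_colors pair_coloring 4 (a, b)).
Proof.
move=> a_gt0 b_gt0 lt_ab; have small : a * 5 + b * 8 < 42 by [].
have check : all (fun p =>
    (gfib p.1 p.2 6 < 2 * fib 8) ==> ~~ uniq (entry_colors pair_coloring 4 p))
  (interval_pairs 8) by [].
have /allP/(_ (a, b)) := check.
by rewrite mem_interval_pairs lt_ab; apply; rewrite /=; lia.
Qed.

(* [F_{d-2} : F_{d-1}] is close enough to [F_5 : F_6] to transfer the bound on
   the last entry from length [d] to length [7]. *)
Lemma gfib_small_start a b d : 3 < d -> 0 < a ->
  (gfib a b d.-1).+1 < 2 * fib d.+1 -> gfib a b 6 < 2 * fib 8.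
Proof.
case: d => [|[|[|[|n]]]] // _ a_gt0; change (gfib a b 6) with (a * 5 + b * 8).
have [] := fib_ratio_bounds n; have := fib_gt0 (ltn0Sn n.+1).
rewrite (fibSS n.+3) (fibSS n.+2) /gfib /=.
move: (fib n.+2) (fib n.+3) => Q P Q_gt0 le_QP le_P2Q le_3P5Q _ small.
have b_le4 : b <= 4 by nia.
have : b = 0 \/ b = 1 \/ b = 2 \/ b = 3 \/ b = 4 by lia.
by case=> [eq_b|[eq_b|[eq_b|[eq_b|eq_b]]]]; subst b; nia.
Qed.

Lemma fib_matrix_rainbow_regular_geq d k : 3 < d ->
  rainbow_partition_regular (fib_matrix d) k -> fib d.+1 <= k.
Proof.
move=> d_gt3 regk; rewrite leqNgt; apply/negP => lt_k.
have k_gt3 : 3 < k := leq_trans d_gt3 (rainbow_partition_regular_dim regk).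
have d_gt2 := ltnW d_gt3.
have /(regk 2 _ isT)/(rainbow_kernelP _ _ d_gt2)[[a b]] :=
  pair_coloring_equinumerous k_gt3.
rewrite mem_kernel_starts // => /and3P[a_gt0 b_gt0 le_last].
move/mkseq_uniqP=> col_inj.
have small : gfib a b 6 < 2 * fib 8.
  by apply: gfib_small_start d_gt3 a_gt0 _; lia.
have /negP := pair_coloring_repeats a_gt0 b_gt0 small; apply.
apply/mkseq_uniqP => i j /= lt_i4 lt_j4.
by apply: col_inj; rewrite inE; apply: leq_trans d_gt3.
Qed.

Definition monochromatic_pairs (N : nat) (c : nat -> nat) : seq (nat * nat) :=
  [seq p <- interval_pairs N | (p.1 != p.2) && (c p.1 == c p.2)].

Lemma size_monochromatic_pairs k n c : equinumerous_coloring k n c ->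
  size (monochromatic_pairs (k * n) c) = k * n * n.-1.
Proof.
move=> [[c_col _] class_size]; rewrite size_filter count_interval_pairs.
transitivity (\sum_(u <- Defs.interval (k * n)) n.-1); last first.
  by rewrite intervalE sum_nat_const_nat subn1.
rewrite big_seq [RHS]big_seq; apply: eq_bigr => u uI.
have <- : size (rem u (color_class (Defs.interval (k * n)) c (c u))) = n.-1.
  by rewrite size_rem ?mem_filter ?eqxx // class_size ?c_col.
rewrite rem_filter ?filter_uniq ?iota_uniq // -filter_predI size_filter.
by apply: eq_count => v; rewrite /= eq_sym [c v == _]eq_sym.
Qed.

Definition entry_pair (i j : nat) (p : nat * nat) : nat * nat :=
  (gfib p.1 p.2 i, gfib p.1 p.2 j).

Lemma entry_pair_inj i j : i < j -> injective (entry_pair i j).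
Proof.
move=> lt_ij [a b] [a' b'] [eq_i eq_j].
by have [-> ->] := gfib_inj lt_ij eq_i eq_j.
Qed.

Lemma entry_colors_repeat d N c p : 2 < d ->
    p \in kernel_starts d N -> p.1 != p.2 -> ~~ uniq (entry_colors c d p) ->
  exists i j, i < j < d /\ entry_pair i j p \in monochromatic_pairs N c.
Proof.
case: p => a b d_gt2 start neq_ab /(uniqPn 0)[i [j [lt_ij lt_jd eq_col]]].
rewrite size_mkseq in lt_jd; have lt_id := ltn_trans lt_ij lt_jd.
rewrite !nth_mkseq //= in eq_col; exists i, j; rewrite lt_ij lt_jd; split=> //.
have := start; rewrite mem_kernel_starts // => /and3P[a_gt0 b_gt0 _].
rewrite mem_filter mem_interval_pairs /= -!mem_interval.
rewrite eq_col eqxx gfib_neq //=.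
by rewrite !(gfib_mem_interval d_gt2 start).
Qed.

Lemma size_kernel_starts_leq d N c : 2 < d ->
    {in kernel_starts d N, forall p, ~~ uniq (entry_colors c d p)} ->
  size (kernel_starts d N) <= N + 'C(d, 2) * size (monochromatic_pairs N c).
Proof.
move=> d_gt2 not_rainbow; set S := kernel_starts d N.
set M := monochromatic_pairs N c.
have S_uniq : uniq S by rewrite filter_uniq ?interval_pairs_uniq.
pose repeats p := \sum_(0 <= j < d) \sum_(0 <= i < j) (entry_pair i j p \in M).
have repeats_gt0 p : p \in S -> 0 < (p.1 == p.2) + repeats p.
  move=> pS; have [//|neq_p] := eqVneq p.1 p.2.
  have [i [j [/andP[lt_ij lt_jd] ijM]]] :=
    entry_colors_repeat d_gt2 pS neq_p (not_rainbow p pS).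
  rewrite /repeats (bigD1_seq j) ?mem_index_iota ?iota_uniq //=.
  by rewrite (bigD1_seq i) ?mem_index_iota ?iota_uniq //= ijM.
apply: (@leq_trans (\sum_(p <- S) ((p.1 == p.2) + repeats p))).
  by rewrite -sum1_size big_seq [X in _ <= X]big_seq; apply: leq_sum.
rewrite big_split /=; apply: leq_add.
  rewrite -big_mkcond sum1_count count_diagonal_leq // => p.
  by rewrite mem_filter => /andP[].
rewrite exchange_big -bin2_sum big_distrl /=; apply: leq_sum => j _.
rewrite exchange_big /= -[X in X * _]subn0 -sum_nat_const_nat.
rewrite big_nat [X in _ <= X]big_nat; apply: leq_sum => i /= lt_ij.
by rewrite -big_mkcond sum1_count count_inj_leq_size //; apply: entry_pair_inj.
Qed.

Lemma ltn_mul_bin2 C D n : 1 < C -> C * 2 < D -> 0 < n ->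
  D * n + C * (D * n * n.-1) < 'C(D * n, 2).
Proof.
case: n => // n C_gt1 lt_CD _; set m := D * n.+1.
have lt_m : 2 + C * n * 2 < m.-1.
  have : (C * 2).+1 * n.+1 <= m by rewrite leq_mul2r lt_CD orbT.
  by lia.
rewrite -(ltn_pmul2r (isT : 0 < 2)) [X in _ < X]mulnC -mul_bin_diag bin1 /=.
have -> : (m + C * (m * n)) * 2 = m * (2 + C * n * 2) by lia.
by rewrite ltn_pmul2l //; lia.
Qed.

Lemma fib_matrix_rainbow_regular d D : 2 < d -> 'C(d, 2) * 2 < D ->
  rainbow_partition_regular (fib_matrix d) (D * (fib (d - 1) * fib (d - 2))).
Proof.
move=> d_gt2 lt_D n c n_gt0; set P := fib (d - 1); set Q := fib (d - 2).
have [P_gt0 Q_gt0] : 0 < P /\ 0 < Q by split; apply: fib_gt0; lia.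
set k := D * (P * Q) => eq_c; apply/rainbow_kernelP => //.
pose is_rainbow p := uniq (entry_colors c d p).
have [/hasP[p pS p_rainbow]|/hasPn not_rainbow] :=
  boolP (has is_rainbow (kernel_starts d (k * n))); first by exists p.
have kE : k * n = P * Q * (D * n) by rewrite /k; lia.
have lower : P * Q * 'C(D * n, 2) <= size (kernel_starts d (k * n)).
  rewrite kE size_filter.
  apply: leq_trans (count_lattice_triangle _ P_gt0 Q_gt0) _.
  by apply: sub_count => p /=; rewrite gfib_last // ltnW.
have upper := size_kernel_starts_leq d_gt2 not_rainbow.
have := leq_trans lower upper; rewrite (size_monochromatic_pairs eq_c) kE.
have -> : P * Q * (D * n) + 'C(d, 2) * (P * Q * (D * n) * n.-1) =
    P * Q * (D * n + 'C(d, 2) * (D * n * n.-1)) by lia.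
rewrite leq_pmul2l ?muln_gt0 ?P_gt0 // leqNgt ltn_mul_bin2 //.
exact: leq_trans (leq_bin2l 2 d_gt2).
Qed.

Theorem theorem2 (d : nat) (hd : 3 < d) :
  exists r : nat,
    is_rainbow_number (fib_matrix d) r /\
    fib d.+1 <= r <= (d ^ 2 - d + 1) * (fib (d - 1) * fib (d - 2)).
Proof.
have lt_D : 'C(d, 2) * 2 < d ^ 2 - d + 1.
  by rewrite mulnC -mul_bin_diag bin1 -mulnn addn1 ltnS -subn1 mulnBr muln1.
have k_gt0 : 0 < (d ^ 2 - d + 1) * (fib (d - 1) * fib (d - 2)).
  by rewrite addn1 !muln_gt0 !fib_gt0 //; lia.
have [r r_min le_r] :=
  is_rainbow_number_exists k_gt0 (fib_matrix_rainbow_regular (ltnW hd) lt_D).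
exists r; split=> //; rewrite le_r andbT.
by have [_ reg_r _] := r_min; apply: fib_matrix_rainbow_regular_geq.
Qed.
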